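(* Let $K$ be an abstract simplicial complex with vertex set $[m]$ and let $(X_i,*_i)$, $1\le i\le m$, be pointed CW-complexes. If all of the $X_i$ are path-connected, then the homotopy theoretic fibre of the inclusion $$Z(K;(\underline{X},\underline{*}))\subset Z(K;(\underline{X},\underline{X}))$$ is $Z(K;(\underline{PX},\underline{\Omega X}))$. Thus, if all of the $X_i$ are path-connected and $1\le j\le m$, the homotopy theoretic fibre of the inclusion $W_j(\prod_{1\le i\le m}X_i)\subset\prod_{1\le i\le m}X_i$, where $W_j(\prod_{1\le i\le m}X_i)=Z(\Delta[m-1]_{j-1};(\underline{X},\underline{*}))$, is $$Z(\Delta[m-1]_{j-1};(\underline{PX},\underline{\Omega X})).$$
   Context: $K$ is a family of subsets (simplices) of $[m]=\{1,\dots,m\}$, closed under passing to subsets, containing $\emptyset$, and such that every $i\in[m]$ lies in some simplex. For a family of pairs of spaces $(\underline{E},\underline{B})=\{(E_i,B_i)\}_{i=1}^m$, $Z(K;(\underline{E},\underline{B}))=\bigcup_{\sigma\in K}D(\sigma)\subset E_1\times\cdots\times E_m$, where $D(\sigma)=\prod_i Y_i$ with $Y_i=E_i$ if $i\in\sigma$ and $Y_i=B_i$ otherwise. Here $(\underline{X},\underline{*})=\{(X_i,\{*_i\})\}$, $(\underline{X},\underline{X})=\{(X_i,X_i)\}$ (so $Z(K;(\underline{X},\underline{X}))=\prod_i X_i$) and $(\underline{PX},\underline{\Omega X})=\{(PX_i,\Omega X_i)\}$. For a pointed space $(X,* )$, $PX$ is the space of continuous maps $f:[0,1]\to X$ with $f(0)=*$,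 and $\Omega X\subset PX$ is the subspace of those with $f(1)=*$. $\Delta[m-1]_q$ is the $q$-skeleton of the $(m-1)$-simplex: all subsets of $[m]$ of cardinality at most $q+1$. $W_j(\prod X_i)$ is the set of $(y_1,\dots,y_m)\in\prod X_i$ with $y_i=*_i$ for at least $m-j$ values of $i$. Homotopy fibres are identified up to homotopy equivalence. *)

(* Defs.v *)
(* MathComp-Analysis: spaces are [topologicalType]s; a subspace is a set used
   as a type ([set_type]), which carries the subspace topology. *)
From HB Require Import structures.
From mathcomp Require Import all_boot all_order all_algebra.
From mathcomp Require Import all_classical all_reals all_analysis homotopy.

Set Implicit Arguments.
Unset Strict Implicit.
Unset Printing Implicit Defensive.

Import Order.TTheory GRing.Theory Num.Theory.
Import numFieldNormedType.Exports.
Local Open Scope classical_set_scope.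
Local Open Scope ring_scope.

Section UnitInterval.
Variable R : realType.

Definition unit_interval : Type := `[0 : R, 1]%classic.

HB.instance Definition _ := Topological.on unit_interval.

Lemma zero_in_itv01 : (0 : R) \in (`[0 : R, 1]%classic : set R).
Proof. by rewrite inE /= in_itv /= lexx ler01. Qed.

Lemma one_in_itv01 : (1 : R) \in (`[0 : R, 1]%classic : set R).
Proof. by rewrite inE /= in_itv /= lexx ler01. Qed.

Definition itv_zero : unit_interval := SigSub zero_in_itv01.
Definition itv_one : unit_interval := SigSub one_in_itv01.

Lemma itv_zero_one : itv_zero != itv_one.
Proof. by apply/eqP => /(congr1 val) /= /eqP; rewrite eq_sym oner_eq0. Qed.

(* After this, [zero] and [one] denote the endpoints, and
   [{path unit_interval R from x to y}] is the library type of paths. *)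
HB.instance Definition _ := isBiPointed.Build unit_interval itv_zero_one.

End UnitInterval.

Section HomotopyTheory.
Variable R : realType.
Local Notation I := (unit_interval R).

Definition path_connected (X : topologicalType) : Prop :=
  forall x y : X, $| {path I from x to y} |.

Definition homotopic (A B : topologicalType) (f g : A -> B) : Prop :=
  exists H : A * I -> B, [/\ continuous H,
    forall a, H (a, zero) = f a & forall a, H (a, one) = g a].

Definition homotopy_equivalent (A B : topologicalType) : Prop :=
  exists (f : A -> B) (g : B -> A), [/\ continuous f, continuous g,
    homotopic (g \o f) idfun & homotopic (f \o g) idfun].

(* [{compact-open, I -> X}] contains all functions, hence the explicit
   continuity requirements in the next definitions. *)
Definition path_space (X : topologicalType) (x0 : X) :
    set {compact-open, I -> X} :=
  [set g | continuous (g : I -> X) /\ g zero = x0].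

Definition loop_space (X : topologicalType) (x0 : X) : set (path_space x0) :=
  [set g | val g one = x0].

Definition homotopy_fibre (A B : topologicalType) (f : A -> B) (b : B) :
    set (A * {compact-open, I -> B}) :=
  [set p | [/\ continuous (p.2 : I -> B), p.2 zero = b & p.2 one = f p.1]].

End HomotopyTheory.

Arguments path_space R {X} x0.
Arguments loop_space R {X} x0.
Arguments homotopy_fibre R {A B} f b.

Section CWComplex.
Variable R : realType.

(* For n = 0 the disc is a point, equal to its open disc, and the sphere is
   empty. *)
Definition sqnorm n (v : 'rV[R]_n) : R := \sum_(i < n) v ord0 i ^+ 2.
Definition disc n : set 'rV[R]_n := [set v | sqnorm v <= 1].
Definition open_disc n : set (@disc n) := [set v | sqnorm (set_val v) < 1].
Definition sphere n : set (@disc n) := [set v | sqnorm (set_val v) = 1].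

Section Structure.
Variables (X : topologicalType) (C : nat -> Type).
Variable Phi : forall n, C n -> @disc n -> X.

Definition open_cell (c : {n & C n}) : set X :=
  Phi (projT2 c) @` @open_disc (projT1 c).

Record is_cw_structure : Prop := IsCWStructure {
  cw_hausdorff : hausdorff_space X;
  cw_continuous : forall n (c : C n), continuous (Phi c);
  (* Each characteristic map is a homeomorphism from the open disc onto
     its image. *)
  cw_injective : forall n (c : C n), set_inj (@open_disc n) (Phi c);
  cw_open : forall n (c : C n) (U : set (@disc n)),
    open U -> U `<=` @open_disc n ->
    exists2 V : set X, open V & Phi c @` U = V `&` open_cell (existT C n c);
  cw_disjoint : trivIset setT open_cell;
  cw_cover : \bigcup_c open_cell c = setT;
  cw_closure_finite : forall n (c : C n),
    exists F : set {k & C k}, [/\ finite_set F,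
      forall d, F d -> (projT1 d < n)%N &
      Phi c @` @sphere n `<=` \bigcup_(d in F) open_cell d];
  cw_weak_topology : forall A : set X,
    closed A <-> forall c, closed (A `&` closure (open_cell c))
}.

End Structure.

Definition cw_complex (X : topologicalType) : Prop :=
  exists (C : nat -> Type) (Phi : forall n, C n -> @disc n -> X),
    is_cw_structure Phi.

End CWComplex.

(* The vertex set {1, ..., m} is represented by 'I_m. *)
Record is_simplicial_complex m (K : {set {set 'I_m}}) : Prop :=
  IsSimplicialComplex {
    simplex_sub : forall s t : {set 'I_m}, s \in K -> t \subset s -> t \in K;
    simplex_empty : finset.set0 \in K;
    simplex_vertex : forall i : 'I_m, [set i]%SET \in K
  }.

Definition simplex_skeleton m q : {set {set 'I_m}} :=
  [set s : {set 'I_m} | (#|s| <= q.+1)%N]%SET.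

Section PolyhedralProduct.
Variables (m : nat) (E : 'I_m -> topologicalType).

Definition polyhedral_block (B : forall i, set (E i)) (s : {set 'I_m}) :
    set (prod_topology E) :=
  [set y | forall i, (if i \in s then [set: E i] else B i) (y i)].

Definition polyhedral_product (K : {set {set 'I_m}}) (B : forall i, set (E i)) :
    set (prod_topology E) :=
  \bigcup_(s in [set` K]) polyhedral_block B s.

Lemma polyhedral_product_sub K (B B' : forall i, set (E i)) :
  (forall i, B i `<=` B' i) ->
  polyhedral_product K B `<=` polyhedral_product K B'.
Proof.
by move=> BB' y [s Ks ys]; exists s => // i; have := ys i; case: ifP => // _ /BB'.
Qed.

Lemma mem_polyhedral_product K (B : forall i, set (E i))
    (y : prod_topology E) : is_simplicial_complex K ->
  (forall i, B i (y i)) -> y \in polyhedral_product K B.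
Proof.
move=> hK By; apply/mem_set; exists finset.set0; first exact: simplex_empty hK.
by move=> i; rewrite finset.inE.
Qed.

End PolyhedralProduct.

Definition set_inclusion (T : Type) (A B : set T) (AB : A `<=` B) (x : A) : B :=
  SigSub (mem_set (AB _ (set_mem (valP x)))).

Section PointedFamily.
Variables (m : nat) (X : 'I_m -> topologicalType) (x0 : forall i, X i).

(* Z(K; (X, * )) *)
Definition Z_pt (K : {set {set 'I_m}}) : set (prod_topology X) :=
  polyhedral_product K (fun i => [set x0 i]).

(* Z(K; (X, X)) *)
Definition Z_full (K : {set {set 'I_m}}) : set (prod_topology X) :=
  polyhedral_product K (fun i => [set: X i]).

Definition Z_inclusion (K : {set {set 'I_m}}) : Z_pt K -> Z_full K :=
  set_inclusion (@polyhedral_product_sub _ _ K _ _ (fun i => @subsetT _ _)).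

Definition Z_basepoint (K : {set {set 'I_m}}) (hK : is_simplicial_complex K) :
    Z_full K :=
  SigSub (@mem_polyhedral_product _ _ K _ (x0 : prod_topology X) hK
    (fun i => Logic.I)).

(* Z(K; (PX, Omega X)) *)
Definition Z_path (R : realType) (K : {set {set 'I_m}}) :
    set (prod_topology (fun i => path_space R (x0 i) : topologicalType)) :=
  @polyhedral_product m (fun i => path_space R (x0 i) : topologicalType) K
    (fun i => loop_space R (x0 i)).

(* W_j(prod X_i) *)
Definition W (j : nat) : set (prod_topology X) :=
  [set y | (m - j <= #|[set i | y i == x0 i]%SET|)%N].

End PointedFamily.

Arguments Z_inclusion {m X} x0 K.
Arguments Z_path {m X} x0 R K.

(* Main.v *)
Require Import Defs.
From mathcomp Require Import all_boot all_order all_algebra.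
From mathcomp Require Import all_classical all_reals all_analysis.

Import numFieldNormedType.Exports.

Local Open Scope classical_set_scope.

(** The homotopy fibre is not merely homotopy equivalent to the polyhedral
product of path spaces: with the mapping path space model the two are
homeomorphic.

A point of the homotopy fibre of Z(K; (X, * )) -> prod_i X_i is a point z of
the source with a path g in the product from the base point to z.  Since z is
the end point of g, it carries no information: the fibre is the space of
based paths g in the product with g(1) in Z(K; (X, * )).  A path in a product
is a family of paths g_i in the X_i, and g(1) lies in the block of a simplex s
exactly when g_i(1) is the base point for every i outside s, that is, when g_i
is a loop for every i outside s.  So the families (g_i) obtained are those of
Z(K; (PX, Omega X)).  These maps are [fibre_to_Z] and [Z_to_fibre].

What remains is that they are continuous for the compact-open topologies.
Towards the path spaces this is composition with a coordinate projection
([compact_open_comp_continuous]).  In the other direction, a map into a mapping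
space is continuous as soon as its adjoint is
([continuous_into_compact_open]), and the adjoint is computed coordinate by
coordinate, where it is an evaluation map; evaluation of paths is jointly
continuous because the interval is compact and regular
([eval_unit_interval_continuous]).

The second half of the theorem is the case of a skeleton: W_j consists of the
points with at most j coordinates off the base point, and the set of those
coordinates is the smallest simplex whose block contains the point. *)

Lemma continuous_into_subspace (U T : topologicalType) (A : set T)
    (f : U -> A) :
  continuous (fun u => val (f u)) -> continuous f.
Proof. exact: continuous_comp_initial. Qed.

Lemma val_continuous (T : topologicalType) (A : set T) :
  continuous (val : A -> T).
Proof. exact: initial_continuous. Qed.

Lemma continuous_into_prod (U : topologicalType) (J : Type)
    (E : J -> topologicalType) (f : U -> prod_topology E) :
  (forall i, continuous (fun u => f u i)) -> continuous f.
Proof.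
move=> cf u; apply/cvg_sup => i.
exact: (@continuous_comp_initial (prod_topology E) U (E i) (fun y => y i) f
  (cf i)).
Qed.

Lemma continuous_into_pair (T U V : topologicalType) (f : T -> U) (g : T -> V) :
  continuous f -> continuous g -> continuous (fun t => (f t, g t)).
Proof. by move=> cf cg t; apply: cvg_pair => //=; [exact: cf|exact: cg]. Qed.

(** The preimage of the subbasic set of all [k] with [k @` L `<=` O] is the
subbasic set for [L] and the preimage of [O] by [h]. *)
Lemma compact_open_comp_continuous (T U V : topologicalType) (h : U -> V) :
  continuous h ->
  continuous ((fun g t => h (g t)) :
    {compact-open, T -> U} -> {compact-open, T -> V}).
Proof.
move=> ch g; apply/compact_open_cvgP => [|L O cL oO hgLO].
  exact/fmap_filter/nbhs_filter.
have : nbhs g ([set k | k @` L `<=` h @^-1` O] : set {compact-open, T -> U}).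
  apply: open_nbhs_nbhs; split.
    by apply: compact_open_open => //; move/continuousP: ch; apply.
  by move=> _ [t Lt <-]; apply: hgLO; exists t.
apply: (@filterS _ _ (nbhs_filter _)) => k kLO _ [t Lt <-].
by apply: kLO; exists t.
Qed.

Lemma continuous_into_compact_open (U V W : topologicalType)
    (f : U -> {compact-open, V -> W}) :
  continuous (fun z : U * V => f z.1 z.2) -> continuous f.
Proof. by move=> /continuous_curry[]. Qed.

(** A filter on the interval is pushed forward to the line, where closed bounded
intervals are compact, and its cluster point is pulled back. *)
Lemma unit_interval_compact (R : realType) : compact [set: unit_interval R].
Proof.
move=> F FF _; pose v (t : unit_interval R) : R := val t.
have vF : (v @ F) `[0%R, 1%R]%classic.
  apply: (@filterS _ F _ setT) filterT => t _; exact: set_mem (valP t).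
have [p [p01 clp]] := @segment_compact R 0%R 1%R (v @ F) _ vF.
exists (SigSub (mem_set p01)); split => // A B FA [_ [[C oC <-]] Cp CB].
have vA : (v @ F) (v @` A) by apply: (@filterS _ F _ A) FA => t At; exists t.
have [_ [[t At <-] Ct]] := clp _ C vA (open_nbhs_nbhs (conj oC Cp)).
by exists t; split=> //; exact: CB.
Qed.

Lemma regular_subspace (T : topologicalType) (A : set T) :
  regular_space T -> regular_space A.
Proof.
move=> regT x U [_ [[C oC <-]] Cx CU].
have [D Dx DC] := regT (val x) C (open_nbhs_nbhs (conj oC Cx)).
exists (val @^-1` D); first exact: val_continuous.
move=> y Dy; apply/CU/DC => E Ey.
have [z [Dz Ez]] := Dy (val @^-1` E) (@val_continuous _ _ _ _ Ey).
by exists (val z).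
Qed.

(** Joint continuity of evaluation, in parametrised form.  Continuity of each
[f u] is a separate hypothesis because the points of the compact-open space are
arbitrary functions, and evaluation is continuous only along continuous ones. *)
Lemma eval_unit_interval_continuous (R : realType) (U W : topologicalType)
    (f : U -> {compact-open, unit_interval R -> W}) :
  continuous f -> (forall u, continuous (f u : unit_interval R -> W)) ->
  continuous (fun z : U * unit_interval R => f z.1 z.2).
Proof.
move=> cf cfu.
rewrite (_ : (fun z => _) = uncurry f); last by apply/funext => -[].
apply: continuous_uncurry_regular => //.
  move=> t _; rewrite withinET; exists setT; first exact: filterT.
  by split; [exact: unit_interval_compact | exact: closedT].
exact: regular_subspace (@uniform_regular R).
Qed.

(** Both composites being identities, the constant homotopies suffice. *)
Lemma homeomorphism_homotopy_equivalent (R : realType) (A B : topologicalType)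
    (f : A -> B) (g : B -> A) :
  continuous f -> continuous g -> cancel f g -> cancel g f ->
  homotopy_equivalent R A B.
Proof.
move=> cf cg fK gK; exists f, g; split=> //.
- by exists fst; split=> [z|a|a]; [exact: cvg_fst | rewrite /= fK | by []].
- by exists fst; split=> [z|a|a]; [exact: cvg_fst | rewrite /= gK | by []].
Qed.

(** The two inclusions of the theorem have as target the polyhedral product
Z(K; (X, X)), which is the whole product seen as a subspace, and the product
itself.  The target is therefore any space [B] identified with the product by
inverse homeomorphisms [p] and [q]. *)
Section FibreIsPolyhedralProduct.
Variables (R : realType) (m : nat) (X : 'I_m -> topologicalType).
Variables (x0 : forall i, X i) (K : {set {set 'I_m}}).
Variables (B : topologicalType) (p : B -> prod_topology X).
Variables (q : prod_topology X -> B).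
Hypotheses (p_cont : continuous p) (q_cont : continuous q).
Hypotheses (pK : cancel p q) (qK : cancel q p).
Local Notation I := (unit_interval R).
Local Notation f := (fun z : Z_pt x0 K => q (val z)).
Local Notation Fib := (homotopy_fibre R f (q x0)).

Lemma coord_continuous i : continuous (fun c : B => p c i).
Proof.
by move=> c; apply: continuous_comp (p_cont c) (@proj_continuous _ X i _).
Qed.

Lemma fibre_path_in_path_space (w : Fib) i :
  path_space R (x0 i) (fun t => p ((val w).2 t) i).
Proof.
have [cw w0 _] := set_valP w; split; last by rewrite w0 qK.
by move=> t; apply: continuous_comp (cw t) (@coord_continuous i _).
Qed.

Definition fibre_path (w : Fib) :
    prod_topology (fun i => path_space R (x0 i) : topologicalType) :=
  fun i => SigSub (mem_set (fibre_path_in_path_space w i)).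

(** The simplex witnessing that the end point of the path lies in
Z(K; (X, * )) also witnesses that the other coordinate paths are loops. *)
Lemma fibre_path_in_Z (w : Fib) : Z_path x0 R K (fibre_path w).
Proof.
have [_ _ w1] := set_valP w; have [s Ks ws] := set_valP (val w).1.
exists s => // i; have := ws i; case: ifP => // _ /= wi.
by rewrite /loop_space /= w1 qK.
Qed.

Definition fibre_to_Z (w : Fib) : Z_path x0 R K :=
  SigSub (mem_set (fibre_path_in_Z w)).

(** Uncurried in [t], this is the adjoint of the passage from families of paths
to paths in the product; at time one it recovers the redundant first component
of a point of the fibre. *)
Definition Z_eval (y : Z_path x0 R K) (t : I) : prod_topology X :=
  fun i => val (val y i) t.

Lemma Z_eval_continuous :
  continuous (fun z : Z_path x0 R K * I => Z_eval z.1 z.2).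
Proof.
pose P j : topologicalType := path_space R (x0 j).
apply: continuous_into_prod => i.
apply: (@eval_unit_interval_continuous R (Z_path x0 R K) (X i)
  (fun y => val (val y i))) => [y|y].
- apply: (@continuous_comp _ _ _ (fun y : Z_path x0 R K => val y i) val).
    exact: (@continuous_comp (Z_path x0 R K) (prod_topology P) (P i) val
      (@proj _ P i) y (@val_continuous _ _ _) (@proj_continuous _ P i _)).
  exact: val_continuous.
- by have [] := set_valP (val y i).
Qed.

Lemma Z_eval_one (y : Z_path x0 R K) : Z_pt x0 K (Z_eval y one).
Proof.
have [s Ks ys] := set_valP y; exists s => // i.
by have := ys i; case: ifP.
Qed.

Lemma Z_eval_in_fibre (y : Z_path x0 R K) :
  homotopy_fibre R f (q x0)
    (SigSub (mem_set (Z_eval_one y)), fun t => q (Z_eval y t)).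
Proof.
split=> //=.
  move=> t; apply: (@continuous_comp _ _ _ (Z_eval y) q); last exact: q_cont.
  apply: (@continuous_comp _ _ _ (fun t => (y, t)) (fun z => Z_eval z.1 z.2)).
    apply: continuous_into_pair; first exact: cst_continuous.
    by move=> ?; exact: cvg_id.
  exact: Z_eval_continuous.
congr q; apply: functional_extensionality_dep => i.
by have [] := set_valP (val y i).
Qed.

Definition Z_to_fibre (y : Z_path x0 R K) : Fib :=
  SigSub (mem_set (Z_eval_in_fibre y)).

Lemma fibre_to_Z_continuous : continuous fibre_to_Z.
Proof.
apply: continuous_into_subspace; apply: continuous_into_prod => i.
apply: continuous_into_subspace => w /=.
apply: (@continuous_comp _ _ _ (fun w : Fib => (val w).2)
  ((fun g t => p (g t) i) : {compact-open, I -> B} -> {compact-open, I -> X i})).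
  apply: (@continuous_comp Fib _ _ val snd w (@val_continuous _ _ _)).
  exact: cvg_snd.
exact: (@compact_open_comp_continuous _ _ _ _ (@coord_continuous i)).
Qed.

Lemma Z_to_fibre_continuous : continuous Z_to_fibre.
Proof.
apply: continuous_into_subspace; apply: continuous_into_pair.
- apply: continuous_into_subspace => /= y.
  apply: (@continuous_comp _ _ _ (fun y => (y, one)) (fun z => Z_eval z.1 z.2)).
    apply: continuous_into_pair; last exact: cst_continuous.
    by move=> ?; exact: cvg_id.
  exact: Z_eval_continuous.
- apply: (@continuous_into_compact_open _ _ _ (fun y t => q (Z_eval y t))) => z.
  apply: continuous_comp; [exact: Z_eval_continuous | exact: q_cont].
Qed.

(** The first component is recovered because the path ends at its image. *)
Lemma fibre_to_ZK : cancel fibre_to_Z Z_to_fibre.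
Proof.
move=> w; have [_ _ w1] := set_valP w; apply: val_inj => /=.
have E (t : I) : Z_eval (fibre_to_Z w) t = p ((val w).2 t) by [].
rewrite [RHS]surjective_pairing; congr pair.
  by apply: val_inj; rewrite /= E w1 qK.
by apply/funext => t; rewrite E pK.
Qed.

Lemma Z_to_fibreK : cancel Z_to_fibre fibre_to_Z.
Proof.
move=> y; apply: val_inj; apply: functional_extensionality_dep => i.
by apply: val_inj; apply/funext => t /=; rewrite qK.
Qed.

Lemma fibre_homotopy_equivalent : homotopy_equivalent R Fib (Z_path x0 R K).
Proof.
exact: homeomorphism_homotopy_equivalent fibre_to_Z_continuous
  Z_to_fibre_continuous fibre_to_ZK Z_to_fibreK.
Qed.

End FibreIsPolyhedralProduct.

(** One inclusion takes as simplex the set of coordinates off the base point;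
in the other, the complement of the simplex consists of coordinates at the base
point.  For [j = 0] the two sides can differ: [j.-1] is then 0 and the skeleton
still contains the vertices. *)
Lemma W_skeleton (m : nat) (X : 'I_m -> topologicalType) (x0 : forall i, X i)
    (j : nat) : (0 < j)%N -> W x0 j = Z_pt x0 (simplex_skeleton m j.-1).
Proof.
move=> j0; apply/seteqP; split=> y.
- move=> Wy; exists (~: [set i | y i == x0 i])%SET => [|i].
    by rewrite /= !inE cardsCs finset.setCK card_ord prednK // leq_subCl.
  by rewrite !inE; case: eqP.
- move=> [s]; rewrite /= !inE prednK // => sj ys.
  have : (#|~: s| <= #|[set i | y i == x0 i]%SET|)%N.
    apply/subset_leq_card/fintype.subsetP => i; rewrite !inE => /negbTE si.
    by have := ys i; rewrite si => /= ->.
  by apply: leq_trans; rewrite cardsCs finset.setCK card_ord leq_sub2l.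
Qed.

Theorem corollary2p32 (R : realType) (m : nat) (X : 'I_m -> topologicalType)
    (x0 : forall i, X i)
    (X_cw : forall i, cw_complex R (X i))
    (X_pc : forall i, path_connected R (X i)) :
  (forall (K : {set {set 'I_m}}) (hK : is_simplicial_complex K),
     homotopy_equivalent R
       (homotopy_fibre R (Z_inclusion x0 K) (Z_basepoint x0 hK))
       (Z_path x0 R K)) /\
  (forall j : nat, (1 <= j <= m)%N ->
     W x0 j = Z_pt x0 (simplex_skeleton m j.-1) /\
     homotopy_equivalent R
       (homotopy_fibre R (set_val : W x0 j -> prod_topology X) x0)
       (Z_path x0 R (simplex_skeleton m j.-1))).
Proof.
split=> [K hK|j /andP[j0 _]].
- pose q (y : prod_topology X) : Z_full K :=
    SigSub (@mem_polyhedral_product m X K (fun i => [set: X i]) y hK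
      (fun i => Logic.I)).
  rewrite (_ : Z_inclusion x0 K = fun z => q (val z)); last first.
    by apply/funext => z; exact: val_inj.
  rewrite (_ : Z_basepoint x0 hK = q x0); last exact: val_inj.
  have q_cont : continuous q.
    by apply: continuous_into_subspace => y; exact: cvg_id.
  have valK : cancel val q by move=> c; exact: val_inj.
  have qK : cancel q val by [].
  exact (@fibre_homotopy_equivalent R m X x0 K (Z_full K) val q
    (@val_continuous _ _) q_cont valK qK).
- split; first exact: W_skeleton.
  rewrite W_skeleton//.
  have id_cont : continuous (id : prod_topology X -> prod_topology X).
    by move=> y; exact: cvg_id.
  exact (@fibre_homotopy_equivalent R m X x0 _ (prod_topology X) id id
    id_cont id_cont (fun=> erefl) (fun=> erefl)).
Qed.
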